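(* Let $E\subseteq\mathbb{R}^{n+1}$ be $(c,\delta,\Phi)$-weakly porous for some $c,\delta\in(0,1)$. For any parabolic rectangle $R(\gamma_0)\subseteq\mathbb{R}^{n+1}$ with $0\le\gamma_0\le1/2$ consider $\mathcal{S}_k=\mathcal{S}_k(\mathcal{G}_\delta^\Phi(R(\gamma_0)),\Lambda)$ with $\Lambda=\delta|\mathcal{M}(R^\Phi(\gamma_0))|$. Then for every $k=1,2,\dots$ the following are true: (i) If $\mathcal{C}\subseteq\mathcal{S}_k$ is any nonempty subcollection such that $\mathcal{C}\subseteq\mathcal{D}_1(\pi P)$ for every $P\in\mathcal{C}$, then $\mathcal{C}$ is a proper subset of $\mathcal{D}_1(\pi P)$. (ii) The collection $\pi^+\mathcal{S}_{k+1}=\{\pi^+P: P\in\mathcal{S}_{k+1}\}$ consists of pairwise disjoint rectangles. (iii) There exists $\lambda=\lambda(n,p,d)\in(0,1)$ such that $$\Big|\bigcup_{Q\in\mathcal{S}_{k+1}}Q\Big|\le\lambda^k\Big|\bigcup_{P\in\mathcal{S}_1}P\Big|.$$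
   Context: Throughout, $n\ge 1$ is an integer, $1<p<\infty$, and $d\ge1$ is a fixed integer with $dp\ge\log_2 9$. Points of $\mathbb{R}^{n+1}$ are written $(x,t)$ with $x\in\mathbb{R}^n$, $t\in\mathbb{R}$; $|\cdot|$ is Lebesgue measure. Fixed parameters: $\theta_0,\phi,\Phi\ge2$ are integers, fixed once and for all in terms of $p,d$, satisfying: (1) $\phi\le\Phi-\theta_0-\lceil\frac{2\theta_0}{2^{dp}-1}\rceil$; (2) $\phi\le\theta_0\le\Phi$; (3) $\Phi\ge\lceil2^{dp}\rceil-1$; (4) $\phi\le\lfloor2^{dp}\rfloor-1-\theta_0-\lceil\frac{2\theta_0}{2^{dp}-1}\rceil$; (5) $\phi-\theta_0\le-\lceil\frac{4\theta_0}{2^{dp}-1}\rceil$. (For example $\theta_0=4$, $\phi=2$, $\Phi=\lceil2^{dp}\rceil-1$.) Parabolic rectangles: for $x\in\mathbb{R}^n$, $t\in\mathbb{R}$, $L>0$, $0\le\gamma\le1/2$, let $Q(x,L)=\prod_{i}[x_i-L/2,x_i+L/2)$ and $R(\gamma)=R(x,t,L,\gamma)=Q(x,L)\times[t-L^p,t-\gamma L^p)$. Side lengths: $l_x(R(\gamma))=L$, $l_t(R(\gamma))=(1-\gamma)L^p$. For $\theta\in\mathbb{R}$, $R^\theta(\gamma)=R(\gamma)+(0,\theta\, l_t(R(\gamma)))$. Dyadic lattice: $\mathcal{D}_1(R(\gamma))$ is the partition of $R(\gamma)$ obtained by dividing each spatial edge into $2^d$ equal half-open intervals and the temporal edge into $k$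 equal half-open intervals, where $k=\lceil 2^{dp}\rceil$ if $0\le\gamma\le 1-\frac{2^{dp}+1}{2^{dp+1}}$ and $k=\lfloor2^{dp}\rfloor$ if $1-\frac{2^{dp}+1}{2^{dp+1}}<\gamma\le\frac12$. Its members are again parabolic rectangles with truncation parameter in $[0,1/2]$. Put $\mathcal{D}_0(R(\gamma))=\{R(\gamma)\}$, $\mathcal{D}_{i+1}(R(\gamma))=\bigcup_{P\in\mathcal{D}_i(R(\gamma))}\mathcal{D}_1(P)$, $\mathcal{D}(R(\gamma))=\bigcup_{i\ge0}\mathcal{D}_i(R(\gamma))$. Extended lattice (a time strip): $\mathcal{D}_i^{\mathrm{ext}}(R(\gamma_0))=\bigcup_{j\in\mathbb{Z}}\mathcal{D}_i(R(\gamma_0)+(0,j\,l_t(R(\gamma_0))))$ and $\mathcal{D}^{\mathrm{ext}}=\bigcup_{i\ge0}\mathcal{D}_i^{\mathrm{ext}}$. Parents: for $P\in\mathcal{D}_m^{\mathrm{ext}}(R(\gamma_0))$, $m\ge1$, $\pi P\in\mathcal{D}_{m-1}^{\mathrm{ext}}(R(\gamma_0))$ is the unique rectangle with $P\in\mathcal{D}_1(\pi P)$; the forward-in-time parent is $\pi^+P=\pi P+(0,\theta_0\,l_t(\pi P))\in\mathcal{D}_{m-1}^{\mathrm{ext}}(R(\gamma_0))$. Set $\pi_0^+P=P$, $\pi_{i+1}^+P=\pi^+(\pi_i^+P)$ for $0\le i\le m-1$, and for $\theta\in\mathbb{R}$, $\pi_i^+P^\theta=\pi_i^+P+(0,\theta\,l_t(\pi_i^+P))$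 (parents are taken before translating). Weak porosity: for a nonempty closed $E$, a set $A$ is $E$-free if $A\cap E=\emptyset$. $\mathcal{F}(R(\gamma_0))$ is the collection of maximal (with respect to inclusion) $E$-free members of $\mathcal{D}(R(\gamma_0))$, and $\mathcal{M}(R(\gamma_0))\in\mathcal{F}(R(\gamma_0))$ is a member with largest $l_x$ ($\mathcal{M}(R(\gamma_0))=\emptyset$ if $\mathcal{F}(R(\gamma_0))=\emptyset$). For $c,\delta\in(0,1)$, $\theta\in\mathbb{R}$, a nonempty closed set $E$ is $(c,\delta,\theta)$-weakly porous if for every parabolic rectangle $R(\gamma_0)$ with $0\le\gamma_0\le1/2$ there are finitely many pairwise disjoint $E$-free $P_1,\dots,P_N\in\mathcal{D}(R(\gamma_0))$ with $|P_k|\ge\delta|\mathcal{M}(R^\theta(\gamma_0))|$ for all $k$ and $\sum_{k=1}^N|P_k|\ge c|R(\gamma_0)|$. Collections: $\mathcal{F}_\delta^\theta(R(\gamma_0))=\{P\in\mathcal{F}(R(\gamma_0)):|P|\ge\delta|\mathcal{M}(R^\theta(\gamma_0))|\}$; with $F_\delta^\theta=\bigcup_{Q\in\mathcal{F}_\delta^\theta(R(\gamma_0))}Q$, $\mathcal{G}_\delta^\theta(R(\gamma_0))=\{P\in\mathcal{D}(R(\gamma_0)):P\cap F_\delta^\theta=\emptyset,\ \pi P\cap F_\delta^\theta\ne\emptyset\}$. Stopping time: for $\Lambda>0$, $m\ge1$, $P\in\mathcal{D}_m^{\mathrm{ext}}(R(\gamma_0))$, $\tau_\Lambda(P)=\min\{k\in\{1,\dots,m\}:\max_{\theta\in[\phi-\theta_0,\Phi-\theta_0]}|\mathcal{M}(\pi_k^+P^\theta)|\ge\Lambda\}$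 (undefined if there is no such $k$ or if $m=0$). For $\mathcal{A}\subseteq\mathcal{D}(R(\gamma_0))$ and $k\ge1$, $\mathcal{S}_k(\mathcal{A},\Lambda)=\bigcup_{P\in\mathcal{A}}\{\pi_i^+P: \tau_\Lambda(\pi_i^+P)=k,\ i=0,1,\dots,\tau_\Lambda(P)-1\}$ (rectangles for which $\tau_\Lambda$ is undefined are omitted). *)

(* Defs.v *)
From HB Require Import structures.
From mathcomp Require Export all_boot all_order all_algebra.
From mathcomp Require Export all_classical all_reals all_analysis.
From mathcomp Require Import lra ring.

Set Implicit Arguments.
Unset Strict Implicit.
Unset Printing Implicit Defensive.

Export Order.TTheory GRing.Theory Num.Theory.
Export numFieldNormedType.Exports.

#[global] Open Scope classical_set_scope.
#[global] Open Scope ring_scope.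

Section Lebesgue.
Variable R : realType.

Definition tcons n (z : n.-tuple (measurableTypeR R) * measurableTypeR R) :
  n.+1.-tuple (measurableTypeR R) := [tuple of z.2 :: z.1].

(* Lebesgue measure on R^n, as an n-fold product measure on the Borel sets. *)
Fixpoint lebesgue_tuple n : set (n.-tuple (measurableTypeR R)) -> \bar R :=
  match n with
  | 0 => dirac [tuple]
  | m.+1 => pushforward (lebesgue_tuple (n := m) \x lebesgue_measure)%E
              (@tcons m)
  end.

(* Lebesgue measure on R^(n+1); row vectors carry the library's topology and
   tuples its sigma-algebra, hence the transport. *)
Definition vol n (A : set ('rV[R]_n * R)) : \bar R :=
  (@lebesgue_tuple n \x lebesgue_measure)%E
    [set z : n.-tuple (measurableTypeR R) * measurableTypeR R |
       A (\row_i tnth z.1 i, z.2)].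

End Lebesgue.

(* The data (x, t, L, gamma) of R(x, t, L, gamma). For n >= 1 these data are
   determined by the point set [rset], so equality of valid [prect]s is
   equality of rectangles. *)
Record prect (R : realType) (n : nat) := Prect {
  centre : 'rV[R]_n ; time : R ; side : R ; trunc : R }.

HB.instance Definition _ R n := gen_eqMixin (prect R n).
HB.instance Definition _ R n := gen_choiceMixin (prect R n).

Section Rectangles.
Variables (R : realType) (n : nat) (p : R) (d : nat).
Implicit Types (P Q : prect R n) (E A : set ('rV[R]_n * R)).

Definition valid_prect P : Prop := 0 < side P /\ 0 <= trunc P <= 1 / 2.

Definition rset P : set ('rV[R]_n * R) :=
  [set z : 'rV[R]_n * R | (forall i, centre P ord0 i - side P / 2 <= z.1 ord0 i
                      < centre P ord0 i + side P / 2) /\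
           time P - side P `^ p <= z.2 < time P - trunc P * side P `^ p].

Definition ltime P : R := (1 - trunc P) * side P `^ p.

(* R^theta *)
Definition shift P (theta : R) : prect R n :=
  Prect (centre P) (time P + theta * ltime P) (side P) (trunc P).

Definition pow2dp : R := 2 `^ (d%:R * p).

Definition ntime (gamma : R) : nat :=
  if gamma <= 1 - (pow2dp + 1) / 2 `^ (d%:R * p + 1)
  then `|Num.ceil pow2dp|%N else `|Num.floor pow2dp|%N.

(* The cell with spatial index j and temporal index i in the subdivision of
   P. [time] and [trunc] solve  t' - L'^p = lower time of the cell  and
   (1 - gamma') L'^p = ltime P / ntime (trunc P); see [rset_child]. *)
Definition child P (j : {ffun 'I_n -> 'I_(2 ^ d)}) (i : nat) : prect R n :=
  let L' := side P / 2 ^+ d in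
  let l' := ltime P / (ntime (trunc P))%:R in
  Prect (\row_a (centre P ord0 a - side P / 2 + ((j a)%:R + 1 / 2) * L'))
        (time P - side P `^ p + i%:R * l' + L' `^ p)
        L'
        (1 - l' / L' `^ p).

Definition D1 P : set (prect R n) :=
  [set Q | exists j (i : 'I_(ntime (trunc P))), Q = child P j i].

Fixpoint Dlev m (R0 : prect R n) : set (prect R n) :=
  match m with
  | 0 => [set R0]
  | m'.+1 => \bigcup_(P in Dlev m' R0) D1 P
  end.

Definition Dyad (R0 : prect R n) : set (prect R n) := \bigcup_m Dlev m R0.

Definition Dext m (R0 : prect R n) : set (prect R n) :=
  \bigcup_(j in [set: int]) Dlev m (shift R0 j%:~R).

(* pi P, relative to the strip of R0; the default value P is only taken when
   P has no parent there. *)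
Definition parent (R0 P : prect R n) : prect R n :=
  xget P [set Q | (exists m, Dext m R0 Q) /\ D1 Q P].

(* pi^+ P *)
Definition fparent (theta0 : int) R0 P : prect R n :=
  shift (parent R0 P) theta0%:~R.

Definition Efree E P : Prop := rset P `&` E = set0.

Definition Fmax E R0 : set (prect R n) :=
  [set P | [/\ Dyad R0 P, Efree E P &
    forall P', Dyad R0 P' -> Efree E P' -> rset P `<=` rset P' ->
      rset P' = rset P]].

(* M(R0) is chosen classically; it is set0 exactly when F(R0) is empty. *)
Definition Mset E R0 : set ('rV[R]_n * R) :=
  xget set0 [set A | exists P, [/\ Fmax E R0 P,
    (forall P', Fmax E R0 P' -> side P' <= side P) & A = rset P]].

Definition weakly_porous (c delta theta : R) E : Prop :=
  [/\ closed E, E !=set0 &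
    forall R0, valid_prect R0 -> exists N (P : 'I_N -> prect R n),
      [/\ forall k, Dyad R0 (P k) /\ Efree E (P k),
          trivIset [set: 'I_N] (fun k => rset (P k)),
          forall k, (delta%:E * vol (Mset E (shift R0 theta))
                     <= vol (rset (P k)))%E &
          (c%:E * vol (rset R0) <= \sum_(k < N) vol (rset (P k)))%E]].

Definition Fdelta E (delta theta : R) R0 : set (prect R n) :=
  [set P | Fmax E R0 P /\
    (delta%:E * vol (Mset E (shift R0 theta)) <= vol (rset P))%E].

(* Only members of level >= 1 have a parent, so R0 itself is excluded. *)
Definition Gdelta E (delta theta : R) R0 : set (prect R n) :=
  let FU := \bigcup_(Q in Fdelta E delta theta R0) rset Q in
  [set P | [/\ exists m, Dlev m.+1 R0 P, rset P `&` FU = set0 &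
               rset (parent R0 P) `&` FU !=set0]].

Definition admissible (theta0 phi Phi : int) : Prop :=
  [/\ [/\ 2 <= theta0, 2 <= phi & 2 <= Phi],
      phi <= Phi - theta0 - Num.ceil (2 * theta0%:~R / (pow2dp - 1)),
      phi <= theta0 <= Phi,
      Num.ceil pow2dp - 1 <= Phi &
      phi <= Num.floor pow2dp - 1 - theta0
               - Num.ceil (2 * theta0%:~R / (pow2dp - 1)) /\
      phi - theta0 <= - Num.ceil (4 * theta0%:~R / (pow2dp - 1))].

Section StoppingTime.
Variables (theta0 phi Phi : int) (E : set ('rV[R]_n * R)) (R0 : prect R n).
Variable Lambda : \bar R.

Definition fparents i P : prect R n := iter i (fparent theta0 R0) P.

(* max over real theta in [phi - theta0, Phi - theta0]; the supremum is
   attained, since the volumes of the M's lie in {0} together with a decreasing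
   null sequence. *)
Definition maxM k P : \bar R :=
  ereal_sup [set vol (Mset E (shift (fparents k P) theta)) |
             theta in `[(phi - theta0)%:~R, (Phi - theta0)%:~R]].

(* tau_Lambda(P) is defined and equal to k *)
Definition tau_is P (k : nat) : Prop :=
  exists m, [/\ Dext m R0 P, (1 <= k <= m)%N, (Lambda <= maxM k P)%E &
    forall j, (1 <= j < k)%N -> ~ (Lambda <= maxM j P)%E].

Definition Sk (A : set (prect R n)) (k : nat) : set (prect R n) :=
  [set Q | exists P N i, [/\ A P, tau_is P N, (i < N)%N, Q = fparents i P &
                             tau_is Q k]].

End StoppingTime.
End Rectangles.

Section LebesgueFacts.
Variable R : realType.

Lemma measurable_tcons n : measurable_fun setT (@tcons R n).
Proof. exact: measurable_cons. Qed.

Lemma lebesgue_tuple_measure n :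
  exists m : {measure set (n.-tuple (measurableTypeR R)) -> \bar R},
    m = @lebesgue_tuple R n :> (set _ -> \bar R).
Proof.
elim: n => [|n [m mE]]; first by exists (dirac [tuple]).
exists (measure_function_pushforward__canonical__measure_function_Measure
  (m \x lebesgue_measure)%E (@measurable_tcons n)).
by rewrite /= -mE.
Qed.

Definition half_open_box n (a b : 'rV[R]_n) (s t : R) : set ('rV[R]_n * R) :=
  [set z : 'rV[R]_n * R | (forall i, a ord0 i <= z.1 ord0 i < b ord0 i) /\ s <= z.2 < t].

Lemma lebesgue_itvco (s t : R) : s <= t ->
  @lebesgue_measure R [set x | s <= x < t] = (t - s)%:E.
Proof.
move=> st.
have -> : [set x | s <= x < t] = `[s, t[%classic by apply/seteqP; split=> x /=; rewrite in_itv.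
rewrite lebesgue_measure_itv /= lte_fin; case: ltP => // ts.
by rewrite (le_anti (introT andP (conj st ts))) subrr.
Qed.

Lemma lebesgue_tuple_box n (a b : 'I_n -> R) : (forall i, a i <= b i) ->
  measurable [set z : n.-tuple (measurableTypeR R) |
                 forall i, a i <= tnth z i < b i] /\
  lebesgue_tuple [set z : n.-tuple (measurableTypeR R) |
                 forall i, a i <= tnth z i < b i] = (\prod_i (b i - a i))%:E.
Proof.
elim: n a b => [|n IH] a b ab.
  have -> : [set z : 0.-tuple (measurableTypeR R) | forall i, a i <= tnth z i < b i] = setT.
    by apply/seteqP; split=> // z _ [].
  by split=> //=; rewrite big_ord0 diracT.
have mco (s t : R) : measurable ([set x | s <= x < t] : set (measurableTypeR R)).
  have -> : [set x | s <= x < t] = `[s, t[%classic by apply/seteqP; split=> x /=; rewrite in_itv.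
  exact: measurable_itv.
split.
  have -> : [set z : n.+1.-tuple (measurableTypeR R) | forall i, a i <= tnth z i < b i] =
    \bigcap_(i in setT) ((fun z => tnth z i) @^-1` [set x | a i <= x < b i]).
    by apply/seteqP; split=> z /= h i; [move=> _; exact: h|exact: (h i I)].
  apply: fin_bigcap_measurable => // i _.
  rewrite -[X in measurable X]setTI.
  exact: measurable_tnth.
rewrite /= /pushforward.
have -> : @tcons R n @^-1` [set z | forall i, a i <= tnth z i < b i] =
  [set z : n.-tuple (measurableTypeR R) | forall i, a (lift ord0 i) <= tnth z i < b (lift ord0 i)]
    `*` [set x | a ord0 <= x < b ord0].
  apply/seteqP; split=> [[z x]|[z x] []] /=.
    move=> h; split=> [i|]; last exact: (h ord0).
    by have := h (lift ord0 i); rewrite tnthS.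
  move=> h1 h2 i; case: (unliftP ord0 i) => [j ->|->] //.
  by rewrite tnthS.
have [m1 m2] := IH (a \o lift ord0) (b \o lift ord0) (fun i => ab _).
have [m mE] := lebesgue_tuple_measure n.
rewrite -mE product_measure1E// mE m2.
rewrite big_ord_recl mulrC EFinM; congr (_ * _)%E; exact: lebesgue_itvco.
Qed.

Lemma vol_box n (a b : 'rV[R]_n) (s t : R) :
  (forall i, a ord0 i <= b ord0 i) -> s <= t ->
  vol (half_open_box a b s t) =
  ((\prod_i (b ord0 i - a ord0 i)) * (t - s))%:E.
Proof.
move=> ab st; rewrite /vol.
set X := (X in (_ \x _)%E X).
have -> : X = [set z : n.-tuple (measurableTypeR R) | forall i, a ord0 i <= tnth z i < b ord0 i]
    `*` [set x | s <= x < t].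
  apply/seteqP; split=> [[z x]|[z x] []] /=; rewrite /X /half_open_box /=.
    by move=> [h ?]; split=> // i; have := h i; rewrite mxE.
  by move=> h ?; split=> // i; rewrite mxE; exact: h.
have [m1 m2] := lebesgue_tuple_box ab.
have [m mE] := lebesgue_tuple_measure n.
rewrite -mE product_measure1E//; last first.
  have -> : [set x | s <= x < t] = `[s, t[%classic by apply/seteqP; split=> x /=; rewrite in_itv.
  exact: measurable_itv.
rewrite mE m2 EFinM; congr (_ * _)%E; exact: lebesgue_itvco.
Qed.
End LebesgueFacts.

Section RectangleFacts.
Variables (R : realType) (n : nat) (p : R) (d : nat).
Implicit Types P : prect R n.

Lemma vol_rset P : valid_prect P ->
  vol (rset p P) = (side P ^+ n * ltime p P)%:E.
Proof.
move=> [L0 /andP[g0 g1]].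
have Lp : 0 < side P `^ p by rewrite powR_gt0.
have -> : rset p P = half_open_box (\row_i (centre P ord0 i - side P / 2))
   (\row_i (centre P ord0 i + side P / 2)) (time P - side P `^ p)
   (time P - trunc P * side P `^ p).
  by apply/seteqP; split=> z [h ?]; split=> // i; have := h i; rewrite !mxE.
rewrite vol_box; last 2 first.
- by move=> i; rewrite !mxE; lra.
- nra.
congr (_ %:E); congr (_ * _); last by rewrite /ltime; ring.
rewrite (eq_bigr (fun=> side P)) ?prodr_const ?card_ord//.
by move=> i _; rewrite !mxE; field.
Qed.

Lemma rset_child P (j : {ffun 'I_n -> 'I_(2 ^ d)}) i : 0 < side P ->
  rset p (child p P j i) =
  let L' := side P / 2 ^+ d in
  let l' := ltime p P / (ntime p d (trunc P))%:R in
  half_open_box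
    (\row_a (centre P ord0 a - side P / 2 + (j a)%:R * L'))
    (\row_a (centre P ord0 a - side P / 2 + (j a).+1%:R * L'))
    (time P - side P `^ p + i%:R * l') (time P - side P `^ p + i.+1%:R * l').
Proof.
move=> L0; rewrite /rset /child /half_open_box /=.
set L' := side P / 2 ^+ d; set l' := ltime p P / _.
have L'0 : L' `^ p != 0 by rewrite gt_eqF// powR_gt0// divr_gt0// exprn_gt0.
have h1 : time P - side P `^ p + i%:R * l' + L' `^ p - L' `^ p
   = time P - side P `^ p + i%:R * l' by ring.
have h2 : time P - side P `^ p + i%:R * l' + L' `^ p - (1 - l' / L' `^ p) * L' `^ p
   = time P - side P `^ p + i.+1%:R * l' by rewrite -natr1; field.
rewrite h1 h2.
have e1 a : centre P ord0 a - side P / 2 + ((j a)%:R + 1 / 2) * L' - L' / 2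
  = centre P ord0 a - side P / 2 + (j a)%:R * L' by field.
have e2 a : centre P ord0 a - side P / 2 + ((j a)%:R + 1 / 2) * L' + L' / 2
  = centre P ord0 a - side P / 2 + (j a).+1%:R * L' by rewrite -natr1; field.
by apply/seteqP; split=> z [h ?]; split=> // a; have := h a; rewrite !mxE e1 e2.
Qed.

Lemma valid_child P (j : {ffun 'I_n -> 'I_(2 ^ d)}) i : 1 < p -> ln 9 / ln 2 <= d%:R * p -> valid_prect P ->
  valid_prect (child p P j i).
Proof.
move=> p1 dp [L0 /andP[g0 g1]].
have L'0 : 0 < side P / 2 ^+ d by rewrite divr_gt0// exprn_gt0.
split => //=.
have L'p : (side P / 2 ^+ d) `^ p = side P `^ p / pow2dp p d.
  rewrite powRM ?invr_ge0 ?exprn_ge0 ?ltW// /pow2dp powRrM powR_mulrn//.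
  by rewrite -powR_inv1 ?exprn_ge0// -!powRrM mulN1r powRN.
have a9 : 9 <= pow2dp p d.
  rewrite /pow2dp /powR pnatr_eq0 /=.
  rewrite -[leLHS](@lnK R) ?posrE// ler_expR.
  by rewrite -ler_pdivrMr ?ln_gt0// ltr1n.
rewrite L'p /ltime /ntime.
have -> : 2 `^ (d%:R * p + 1) = pow2dp p d * 2 :> R.
  by rewrite /pow2dp powRD ?powRr1//; apply/implyP => _; rewrite pnatr_eq0.
move: a9; set a := pow2dp p d; move=> a9.
have Lp : side P `^ p != 0 by rewrite gt_eqF// powR_gt0.
have cast (z : int) : 0 <= z -> (`|z|%N%:R : R) = z%:~R.
  by move=> z0; rewrite natr_absz ger0_norm.
set k := if _ then _ else _.
have kE : a - 1 < k%:R :> R /\ (1 - trunc P) * a <= k%:R /\ k%:R <= 2 * (1 - trunc P) * a.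
  rewrite /k; case: ifPn => gk.
    rewrite cast ?ceil_ge0; last lra.
    have ha : (a + 1) / (a * 2) * (a * 2) = a + 1 by rewrite divfK// mulf_neq0//; lra.
    have h1 := ceil_ge a; have h2 := ceilB1_lt a; rewrite rmorphB /= in h2.
    have : (a + 1) / (a * 2) * (a * 2) <= (1 - trunc P) * (a*2) by apply: ler_wpM2r; lra.
    rewrite ha; nra.
  rewrite cast; last by rewrite floor_ge0; lra.
  move: gk; rewrite -ltNge => gk.
  have ha : (a + 1) / (a * 2) * (a * 2) = a + 1 by rewrite divfK// mulf_neq0//; lra.
  have h1 := floor_le a; have h2 := floorD1_gt a; rewrite rmorphD /= in h2.
  have : (1 - trunc P) * (a*2) < (a + 1) / (a * 2) * (a * 2) by rewrite ltr_pM2r; lra.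
  rewrite ha; nra.
case: kE => k1 [k2 k3].
have k0 : 0 < k%:R :> R by lra.
have -> : (1 - trunc P) * side P `^ p / k%:R / (side P `^ p / a) = (1 - trunc P) * a / k%:R.
  by field; rewrite Lp /= !gt_eqF//; lra.
have e1 : (1 - trunc P) * a / k%:R <= 1 by rewrite ler_pdivrMr// mul1r.
have e2 : 1 / 2 <= (1 - trunc P) * a / k%:R by rewrite ler_pdivlMr//; lra.
by lra.
Qed.
End RectangleFacts.

(* Main.v *)
Require Import Defs.
From mathcomp Require Import lra ring zify.

Set Implicit Arguments.
Unset Strict Implicit.
Unset Printing Implicit Defensive.

(* Index the cells of level m of the time strip by integers (a, z): the parent
   of (a, z) is (a / 2^d, z / k_m), where k_m is the number of temporal pieces,
   and pi^+ adds theta0 to the temporal index. Following pi^+ from P in G for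
   i >= 1 steps overshoots the ancestor of P by at most
   theta0 + ceil(2 theta0 / (2^dp - 1)) < k_m cells. Next to P, inside pi P,
   there is a large free rectangle S, while M is small at every intermediate
   stage of the chain.

   (i) If all children of B were in S_k, then the one which is temporally last
   would force S to lie in some child of B, where no such S is allowed.
   (ii) If Y = pi_j^+ P' is strictly inside X = pi_i^+ P, the rectangle S of P'
   lies in X or in the preceding translate of X, where M is small.
   (iii) By (i), S_{k+1} omits a child of each parent B, hence covers at most
   the fraction lambda of B. The translates pi^+ S_{k+1} of these B are disjoint
   by (ii), and they belong to S_k. *)

(** * Volume as a measure, and measures of countable unions *)

Section Measure.
Variable R : realType.

(** The sigma-algebra lives on tuples while rectangles are sets of row vectors, so measurability is
    always asserted of preimages under this map. *)
Definition vol_point n (z : n.-tuple (measurableTypeR R) * measurableTypeR R) :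
  'rV[R]_n * R := (\row_i tnth z.1 i, z.2).

Lemma vol_measure n : exists mu : {measure set
    (n.-tuple (measurableTypeR R) * measurableTypeR R) -> \bar R},
  forall A : set ('rV[R]_n * R), vol A = mu (@vol_point n @^-1` A).
Proof.
have [m mE] := lebesgue_tuple_measure R n.
exists (m \x lebesgue_measure)%E => A.
by rewrite /vol -mE.
Qed.

Lemma measurable_box n (a b : 'rV[R]_n) (s t : R) :
  (forall i, a ord0 i <= b ord0 i) ->
  measurable (@vol_point n @^-1` half_open_box a b s t).
Proof.
move=> ab.
have -> : @vol_point n @^-1` half_open_box a b s t =
    [set z : n.-tuple (measurableTypeR R) |
       forall i, a ord0 i <= tnth z i < b ord0 i] `*` `[s, t[%classic.
  apply/seteqP; split=> [[z x]|[z x]]; rewrite /half_open_box /= in_itv /=.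
    by move=> [h ?]; split=> // i; have := h i; rewrite mxE.
  by move=> [h ?]; split=> // i; rewrite mxE; exact: h.
apply: measurableX; last exact: measurable_itv.
by have [] := lebesgue_tuple_box ab.
Qed.

Definition fiber (T I : Type) (D : set I) (f : I -> nat) (F : I -> set T) k :=
  \bigcup_(i in [set i | D i /\ f i = k]) F i.

Lemma bigcup_fiber (T I : Type) (D : set I) (f : I -> nat) (F : I -> set T) :
  \bigcup_(i in D) F i = \bigcup_k fiber D f F k.
Proof.
apply/seteqP; split=> x [i].
  by move=> Di Fx; exists (f i) => //; exists i.
by move=> _ [j [Dj _] Fx]; exists j.
Qed.

(** The index is chosen before [F], so one index serves two families compared over the same [D]. *)
Lemma fiberP (T I : Type) (D : set I) (f : I -> nat) k :
  {in D &, injective f} ->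
  (forall F : I -> set T, fiber D f F k = set0) \/
  exists2 i, D i & f i = k /\ forall F : I -> set T, fiber D f F k = F i.
Proof.
move=> fI; have [[i [Di fi]]|no] := pselect (exists i, D i /\ f i = k).
  right; exists i => //; split=> // F.
  rewrite /fiber (_ : [set _ | _] = [set i]) ?bigcup_set1//.
  apply/seteqP; split=> [j [Dj fj]|j ->] //=.
  by apply: fI; rewrite ?inE// fj fi.
left=> F; rewrite /fiber (_ : [set _ | _] = set0) ?bigcup_set0//.
by apply/seteqP; split=> // j Hj; apply: no; exists j.
Qed.

Lemma measurable_fiber d (T : sigmaRingType d) (I : Type) (D : set I)
    (f : I -> nat) (F : I -> set T) : {in D &, injective f} ->
  (forall i, D i -> measurable (F i)) -> forall k, measurable (fiber D f F k).
Proof.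
move=> fI mF k.
by have [->|[i Di [_ ->]]] := fiberP T k fI; [exact: measurable0|exact: mF].
Qed.

Lemma countable_bigcup_measurable d (T : sigmaRingType d) (I : Type)
    (D : set I) (F : I -> set T) : countable D ->
  (forall i, D i -> measurable (F i)) -> measurable (\bigcup_(i in D) F i).
Proof.
move=> /countable_injP[f fI] mF; rewrite (bigcup_fiber _ f).
by apply: bigcup_measurable => k _; exact: measurable_fiber.
Qed.

(** Subadditivity handles the sets [A], which may overlap; disjointness is asked only of the sets
    [B], where additivity is needed. *)
Lemma le_measure_bigcup d (T : sigmaRingType d) (mu : {measure set T -> \bar R})
    (I : Type) (D : set I) (A B : I -> set T) (c : R) : 0 <= c ->
  countable D -> trivIset D B ->
  (forall i, D i -> measurable (A i)) -> (forall i, D i -> measurable (B i)) ->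
  (forall i, D i -> (mu (A i) <= c%:E * mu (B i))%E) ->
  (mu (\bigcup_(i in D) A i) <= c%:E * mu (\bigcup_(i in D) B i))%E.
Proof.
move=> c0 Dc tB mA mB AB; have /countable_injP[f fI] := Dc.
rewrite !(bigcup_fiber _ f) (measure_bigcup mu setT (fiber D f B)); last 2 first.
- by move=> k _; exact: measurable_fiber.
- move=> k l _ _ [x []].
  have [->//|[i Di [<- ->]]] := fiberP T k fI.
  have [->//|[j Dj [<- ->]]] := fiberP T l fI.
  by move=> Bi Bj; congr f; apply: tB => //; exists x.
rewrite -nneseriesZl; last by move=> *; exact: measure_ge0.
have mU : measurable (\bigcup_k fiber D f A k).
  by apply: bigcup_measurable => k _; exact: measurable_fiber.
have := measure_sigma_subadditive mu (measurable_fiber fI mA) mU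
  (@subset_refl _ _).
move=> /le_trans; apply.
rewrite [leRHS](eq_eseriesl (Q := xpredT)); last by move=> k; rewrite in_setT.
apply: lee_nneseries => [k _ _|k _]; first exact: measure_ge0.
have [e|[i Di [_ e]]] := fiberP T k fI; last by rewrite !e; exact: AB.
by rewrite !e measure0 mule0.
Qed.
End Measure.

Lemma divzMA_nat (z : int) (b c : nat) :
  (z %/ (b * c)%N)%Z = ((z %/ b)%Z %/ c)%Z.
Proof. by rewrite PoszM divzMA_ge0. Qed.

Lemma prect_eta (R : realType) n (P Q : prect R n) :
  centre P = centre Q -> time P = time Q -> side P = side Q ->
  trunc P = trunc Q -> P = Q.
Proof. by case: P Q => [? ? ? ?] [? ? ? ?] /= -> -> -> ->. Qed.

(** * Integer coordinates on the dyadic strip *)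

Section Cells.
Variables (R : realType) (n : nat) (p : R) (d : nat) (R0 : prect R n).
Hypotheses (hp : 1 < p) (hd : (1 <= d)%N) (hdp : ln 9 / ln 2 <= d%:R * p).
Hypothesis R0V : valid_prect R0.
Implicit Types (a b : 'I_n -> nat) (z w : int) (P Q : prect R n).

Definition cside m : R := side R0 / (2 ^+ d) ^+ m.

(** The recurrence is that of [child]. The truncation depends on the level alone, so all cells of
    one level are translates of each other. *)
Fixpoint ctrunc m : R :=
  match m with
  | 0 => trunc R0
  | m'.+1 => 1 - (1 - ctrunc m') * cside m' `^ p
                   / (ntime p d (ctrunc m'))%:R / cside m'.+1 `^ p
  end.

Definition csteps m := ntime p d (ctrunc m).

Definition cltime m := (1 - ctrunc m) * cside m `^ p.

(* The rectangle of level [m] with lower corner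
   (x0 + a * cside m, t0 + z * cltime m), where (x0, t0) is the lower corner
   of R0. *)
Definition cell m a z : prect R n :=
  Prect (\row_i (centre R0 ord0 i - side R0 / 2 + ((a i)%:R + 1 / 2) * cside m))
        (time R0 - side R0 `^ p + z%:~R * cltime m + cside m `^ p)
        (cside m) (ctrunc m).

Lemma pow2dp_ge9 : 9 <= pow2dp p d.
Proof.
rewrite /pow2dp /powR pnatr_eq0 /=.
rewrite -[leLHS](@lnK R) ?posrE// ler_expR.
by rewrite -ler_pdivrMr ?ln_gt0// ltr1n.
Qed.

Lemma ntime_bounds gamma :
  Num.floor (pow2dp p d) <= (ntime p d gamma)%:Z <= Num.ceil (pow2dp p d).
Proof.
have h9 := pow2dp_ge9.
have f0 : 0 <= Num.floor (pow2dp p d) by rewrite floor_ge0; lra.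
have c0 : 0 <= Num.ceil (pow2dp p d) by rewrite ceil_ge0; lra.
have fc : Num.floor (pow2dp p d) <= Num.ceil (pow2dp p d).
  by rewrite -(ler_int R); apply: le_trans (floor_le _) (ceil_ge _).
rewrite /ntime; case: ifP => _; rewrite gez0_abs// ?lexx ?fc ?andbT//.
Qed.

Lemma floor_ge9 : 9 <= Num.floor (pow2dp p d).
Proof. by rewrite floor_ge_int; exact: pow2dp_ge9. Qed.

Lemma ceil_ge9 : (9 <= `|Num.ceil (pow2dp p d)|)%N.
Proof. by have := ntime_bounds 0; have := floor_ge9; lia. Qed.

Lemma csteps_ge9 m : (9 <= csteps m)%N.
Proof.
have := ntime_bounds (ctrunc m); rewrite -/(csteps m).
by have := floor_ge9; lia.
Qed.

Lemma csteps_gt0 m : (0 < csteps m)%N.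
Proof. by rewrite (leq_trans _ (csteps_ge9 m)). Qed.

Lemma csideS m : cside m.+1 = cside m / 2 ^+ d.
Proof. by rewrite /cside exprSr invfM mulrA. Qed.

Lemma cside_gt0 m : 0 < cside m.
Proof. by case: R0V => L0 _; rewrite divr_gt0// !exprn_gt0. Qed.

Lemma cside_lt m r : (m < r)%N -> cside r < cside m.
Proof.
have lt1 k : cside k.+1 < cside k.
  rewrite csideS ltr_pdivrMr ?exprn_gt0// ltr_pMr ?cside_gt0//.
  by rewrite exprn_egt1 ?ltr1n// -lt0n.
elim: r => // r IH; rewrite ltnS leq_eqVlt => /predU1P[->|/IH].
  exact: lt1.
exact: lt_trans.
Qed.

Lemma cside_inj : injective cside.
Proof.
move=> m r; have [/cside_lt|/cside_lt|->//] := ltngtP m r => + e;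
  by rewrite e ltxx.
Qed.

Lemma cltimeS m : cltime m = (csteps m)%:R * cltime m.+1.
Proof.
have h : cside m.+1 `^ p != 0 by rewrite gt_eqF// powR_gt0// cside_gt0.
have h2 : (csteps m)%:R != 0 :> R by rewrite pnatr_eq0 -lt0n csteps_gt0.
by rewrite {2}/cltime /= -/(csteps m) -/(cltime m); field; rewrite h.
Qed.

Lemma cell0 z : cell 0 (fun=> 0%N) z = shift p R0 z%:~R.
Proof.
apply: prect_eta => //=.
- by apply/rowP => i; rewrite mxE /cside expr0 divr1; field.
- by rewrite /cside expr0 divr1 /cltime /ltime /cside /= expr0 divr1; ring.
- by rewrite /cside expr0 divr1.
Qed.

Lemma shift_cell m a z (j : int) :
  shift p (cell m a z) j%:~R = cell m a (z + j).
Proof.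
by apply: prect_eta => //=; rewrite /ltime /= -/(cltime m) intrD; ring.
Qed.

Lemma child_cell m a z (j : {ffun 'I_n -> 'I_(2 ^ d)}) (i : nat) :
  child p (cell m a z) j i =
  cell m.+1 (fun x => a x * 2 ^ d + j x)%N (z * csteps m + i%:Z).
Proof.
have d0 : (2 ^+ d : R) != 0 by rewrite expf_neq0.
apply: prect_eta => //=.
- apply/rowP => x; rewrite !mxE /= csideS natrD natrM natrX.
  by field.
- rewrite -csideS /ltime /= -/(csteps m) -/(cltime m) cltimeS.
  have h2 : (csteps m)%:R != 0 :> R by rewrite pnatr_eq0 -lt0n csteps_gt0.
  by rewrite intrD intrM /=; field.
- by rewrite csideS.
- by rewrite -csideS.
Qed.

Lemma cell_valid m a z : valid_prect (cell m a z).
Proof.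
split; first exact: cside_gt0.
rewrite /=; elim: m => [|m IH]; first by case: R0V.
have V : valid_prect (cell m (fun=> 0%N) 0) by split=> //; exact: cside_gt0.
(* Any child will do, since validity involves only the side and the truncation. *)
have j : {ffun 'I_n -> 'I_(2 ^ d)}.
  exact: [ffun=> Ordinal (expn_gt0 2 d : 0 < 2 ^ d)%N].
by have [_] := valid_child j 0 hp hdp V; rewrite child_cell.
Qed.

Lemma cltime_gt0 m : 0 < cltime m.
Proof.
have [/= _ ?] := cell_valid m (fun=> 0%N) 0.
by rewrite mulr_gt0 ?powR_gt0 ?cside_gt0//; lra.
Qed.

Lemma cell_inj m r a b z w : cell m a z = cell r b w ->
  [/\ m = r, a = b & z = w].
Proof.
move=> e; have mr : m = r by apply: cside_inj; have := congr1 (@side _ _) e.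
subst r; split=> //.
  apply: funext => i; have /rowP/(_ i) := congr1 (@centre _ _) e.
  rewrite !mxE => /addrI/mulIf; rewrite gt_eqF ?cside_gt0// => /(_ isT)/addIr.
  by move=> /eqP; rewrite eqr_nat => /eqP.
have /= /addIr/addrI/mulIf := congr1 (@time _ _) e.
by rewrite gt_eqF ?cltime_gt0// => /(_ isT)/eqP; rewrite eqr_int => /eqP.
Qed.

Definition csize m := cside m ^+ n * cltime m.

Lemma csize_gt0 m : 0 < csize m.
Proof. by rewrite mulr_gt0 ?exprn_gt0 ?cside_gt0 ?cltime_gt0. Qed.

Lemma vol_cell m a z : vol (rset p (cell m a z)) = (csize m)%:E.
Proof. by rewrite vol_rset//; exact: cell_valid. Qed.

Lemma csizeS m : csize m = ((2 ^ d) ^ n * csteps m)%:R * csize m.+1.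
Proof.
rewrite /csize cltimeS (csideS m) natrM natrX natrX.
rewrite [(cside m / _) ^+ n]expr_div_n.
have : (2 ^+ d ^+ n : R) != 0 by rewrite !expf_neq0.
by move: (2 ^+ d ^+ n) (cside m ^+ n) => x y x0; field.
Qed.

Lemma csize_homo m r : (m <= r)%N -> csize r <= csize m.
Proof.
elim: r => [|r IH]; first by rewrite leqn0 => /eqP ->.
rewrite leq_eqVlt => /predU1P[->//|/IH]; apply: le_trans.
have h1 : 1 <= ((2 ^ d) ^ n * csteps r)%:R :> R.
  by rewrite ler1n muln_gt0 csteps_gt0 !expn_gt0.
by rewrite (csizeS r) ler_peMl // ltW ?csize_gt0.
Qed.

Lemma rset_cell m a z : rset p (cell m a z) =
  half_open_box
    (\row_i (centre R0 ord0 i - side R0 / 2 + (a i)%:R * cside m))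
    (\row_i (centre R0 ord0 i - side R0 / 2 + (a i).+1%:R * cside m))
    (time R0 - side R0 `^ p + z%:~R * cltime m)
    (time R0 - side R0 `^ p + (z + 1)%:~R * cltime m).
Proof.
have e1 (x : R) : (x + 1 / 2) * cside m - cside m / 2 = x * cside m by field.
have e2 (x : R) : (x + 1 / 2) * cside m + cside m / 2 = (x + 1) * cside m.
  by field.
have e3 : cltime m = cside m `^ p - ctrunc m * cside m `^ p.
  by rewrite /cltime mulrBl mul1r.
apply/seteqP; split=> -[u t] /= [h1 h2]; split=> /=.
- by move=> i; have := h1 i; rewrite !mxE -!addrA e1 e2 natr1.
- by move: h2; rewrite /= intrD mulrDl mul1r; lra.
- by move=> i; have := h1 i; rewrite !mxE -!addrA e1 e2 natr1.
- by move: h2; rewrite /= intrD mulrDl mul1r; lra.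
Qed.

Lemma rset_cell0 m a z : rset p (cell m a z) !=set0.
Proof.
rewrite rset_cell; exists
  (\row_i (centre R0 ord0 i - side R0 / 2 + (a i)%:R * cside m),
   time R0 - side R0 `^ p + z%:~R * cltime m); split=> /= [i|].
  by rewrite !mxE lexx /= ltrD2l ltr_pM2r ?cside_gt0// ltr_nat.
by rewrite lexx /= ltrD2l ltr_pM2r ?cltime_gt0// ltr_int; lia.
Qed.

Lemma cell_meet m a b z w :
  rset p (cell m a z) `&` rset p (cell m b w) !=set0 -> a = b /\ z = w.
Proof.
rewrite !rset_cell => -[[u t] [/= [h1 h2] [h3 h4]]]; split.
  apply: funext => i; move: (h1 i) (h3 i); rewrite !mxE /=.
  move=> /andP[k1 k2] /andP[k3 k4].
  have := le_lt_trans k1 k4; have := le_lt_trans k3 k2.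
  rewrite !ltrD2l !ltr_pM2r ?cside_gt0// !ltr_nat; lia.
move: h2 h4 => /= /andP[k1 k2] /andP[k3 k4].
have := le_lt_trans k1 k4; have := le_lt_trans k3 k2.
rewrite !ltrD2l !ltr_pM2r ?cltime_gt0// !ltr_int; lia.
Qed.

(** Each cell of level [m] is cut in time into this many pieces of level [m + r]. *)
Definition nsteps m r : nat := \prod_(m <= j < m + r) csteps j.

Lemma nsteps0 m : nsteps m 0 = 1%N.
Proof. by rewrite /nsteps addn0 big_geq. Qed.

Lemma nstepsS m r : nsteps m r.+1 = (csteps m * nsteps m.+1 r)%N.
Proof. by rewrite /nsteps big_ltn ?addnS ?addSn// ltnS leq_addr. Qed.

Lemma nstepsSr m r : nsteps m r.+1 = (csteps (m + r) * nsteps m r)%N.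
Proof. by rewrite /nsteps addnS big_nat_recr ?leq_addr//= mulnC. Qed.

Lemma D1_cell m a z Q : D1 p d (cell m a z) Q <->
  exists b w, [/\ Q = cell m.+1 b w, forall i, (b i %/ 2 ^ d)%N = a i &
                  (w %/ csteps m)%Z = z].
Proof.
have k0 := csteps_gt0 m.
split=> [[j [i ->]]|[b [w [-> ab wz]]]].
  rewrite child_cell; do 2 eexists; split=> [//|x|].
    by rewrite divnMDl ?expn_gt0// divn_small ?addn0.
  by rewrite divzMDl ?gt_eqF// divz_small ?addr0//= ltz_nat ltn_ord.
have jP x : (b x %% 2 ^ d < 2 ^ d)%N by rewrite ltn_mod expn_gt0.
have iP : (`|(w %% csteps m)%Z| < csteps m)%N.
  have k0z : 0 < (csteps m)%:Z by [].
  by have := ltz_pmod w k0z; have := modz_ge0 w (lt0r_neq0 k0z); lia.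
exists [ffun x => Ordinal (jP x)], (Ordinal iP).
rewrite child_cell /=; congr cell.
  by apply: funext => x; rewrite ffunE /= -ab -divn_eq.
by rewrite -wz gez0_abs ?modz_ge0 ?gt_eqF// -divz_eq.
Qed.

Lemma Dlev_cell r m a z Q : Dlev p d r (cell m a z) Q <->
  exists b w, [/\ Q = cell (m + r) b w, forall i, (b i %/ (2 ^ d) ^ r)%N = a i &
                  (w %/ nsteps m r)%Z = z].
Proof.
elim: r Q => [|r IH] Q /=.
  rewrite addn0 nsteps0; split=> [->|[b [w [-> ab wz]]]].
    by exists a, z; split=> // [i|]; rewrite ?divn1 ?divz1.
  congr cell; last by rewrite -wz divz1.
  by apply: funext => i; rewrite -ab divn1.
rewrite addnS nstepsSr; split.
  case=> P /IH[b [w [-> ab wz]]] /D1_cell[b' [w' [-> ab' wz']]].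
  exists b', w'; split=> // [i|]; first by rewrite expnS divnMA ab'.
  by rewrite divzMA_nat wz'.
case=> b [w [-> ab wz]].
exists (cell (m + r) (fun i => b i %/ 2 ^ d)%N (w %/ csteps (m + r))%Z); last first.
  by apply/D1_cell; exists b, w.
apply/IH; do 2 eexists; split=> [//|i|]; first by rewrite -divnMA -expnS.
by rewrite -divzMA_nat.
Qed.

Lemma Dyad_cell m a z Q : Dyad p d (cell m a z) Q <->
  exists r b w, [/\ Q = cell (m + r) b w,
     forall i, (b i %/ (2 ^ d) ^ r)%N = a i & (w %/ nsteps m r)%Z = z].
Proof.
split=> [[r _ /Dlev_cell[b [w]]]|[r [b [w h]]]]; first by exists r, b, w.
by exists r => //; apply/Dlev_cell; exists b, w.
Qed.

(** The condition on [a] places the spatial base inside that of [R0]; [z] is unrestricted because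
    the strip is infinite in time. *)
Lemma Dext_cell m Q : Dext p d m R0 Q <->
  exists a z, Q = cell m a z /\ forall i, (a i %/ (2 ^ d) ^ m)%N = 0%N.
Proof.
split=> [[j _]|[a [z [-> a0]]]].
  by rewrite -cell0 => /Dlev_cell[b [w [-> ? _]]]; exists b, w.
exists (z %/ nsteps 0 m)%Z => //; rewrite -cell0.
by apply/Dlev_cell; exists a, z.
Qed.

Lemma R0_cell : R0 = cell 0 (fun=> 0%N) 0.
Proof. by rewrite cell0; apply: prect_eta => //=; rewrite mul0r addr0. Qed.

Lemma Dlev_sub r m a z Q : Dlev p d r (cell m a z) Q ->
  rset p Q `<=` rset p (cell m a z).
Proof.
elim: r Q => [|r IH] Q /=; first by move=> ->.
case=> P PD PQ; suff h : rset p Q `<=` rset p P.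
  exact: subset_trans h (IH _ PD).
have [b [w [eP _ _]]] := (Dlev_cell _ _ _ _ _).1 PD.
move: PQ; rewrite eP => /D1_cell[b' [w' [-> bb ww]]] [u t].
rewrite !rset_cell => -[/= h1 h2]; split=> /= [i|].
  move: (h1 i); rewrite !mxE => /andP[k1 k2].
  have s0 := cside_gt0 (m + r).+1.
  have -> : cside (m + r) = (2 ^ d)%:R * cside (m + r).+1.
    by rewrite natrX mulrC (csideS (m + r)) divfK// expf_neq0.
  apply/andP; split.
    apply: le_trans k1; rewrite lerD2l mulrA ler_pM2r// -natrM ler_nat.
    by rewrite -bb leq_trunc_div.
  apply: lt_le_trans k2 _; rewrite lerD2l mulrA ler_pM2r// -natrM ler_nat.
  by rewrite -bb ltn_ceil// expn_gt0.
have k0 : 0 < (csteps (m + r))%:Z by exact: csteps_gt0.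
move: h2; rewrite /= => /andP[k1 k2].
have lE (v : int) : v%:~R * cltime (m + r) =
    (v * csteps (m + r))%:~R * cltime (m + r).+1.
  by rewrite (cltimeS (m + r)) mulrA intrM.
rewrite !lE.
apply/andP; split.
  apply: le_trans k1; rewrite lerD2l ler_pM2r ?cltime_gt0// ler_int.
  by rewrite -ww lez_floor// gt_eqF.
apply: lt_le_trans k2 _; rewrite lerD2l ler_pM2r ?cltime_gt0// ler_int.
have := ltz_ceil w' k0; rewrite -ww; lia.
Qed.

(** The ancestor of level [m] of the second cell contains it and so meets the first cell; meeting
    cells of the same level coincide. *)
Lemma cell_meet_anc m r a b z w :
  rset p (cell m a z) `&` rset p (cell (m + r) b w) !=set0 ->
  (forall i, (b i %/ (2 ^ d) ^ r)%N = a i) /\ (w %/ nsteps m r)%Z = z.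
Proof.
move=> [u [u1 u2]].
have : rset p (cell m a z) `&` rset p
    (cell m (fun i => b i %/ (2 ^ d) ^ r)%N (w %/ nsteps m r)%Z) !=set0.
  by exists u; split=> //; apply: Dlev_sub u2; apply/Dlev_cell; exists b, w.
by move=> /cell_meet[-> ->].
Qed.

Lemma parent_cell m a z : (forall i, (a i %/ (2 ^ d) ^ m.+1)%N = 0%N) ->
  parent p d R0 (cell m.+1 a z) =
  cell m (fun i => a i %/ 2 ^ d)%N (z %/ csteps m)%Z.
Proof.
move=> a0; rewrite /parent; set S := (X in xget _ X).
have : exists Q, S Q.
  exists (cell m (fun i => a i %/ 2 ^ d)%N (z %/ csteps m)%Z); split.
    exists m; apply/Dext_cell; do 2 eexists; split=> // i.
    by rewrite -divnMA -expnS.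
  by apply/D1_cell; exists a, z.
move=> /(xgetPex (cell m.+1 a z)); set Q := xget _ _.
case=> -[r /Dext_cell[b [w [-> _]]]] /D1_cell[b' [w' [+ ab wz]]].
move=> /cell_inj[e -> ->]; case: e => ->; congr cell; last by rewrite wz.
by apply: funext => i; rewrite ab.
Qed.

Lemma Dyad_trans P Q S : Dyad p d P Q -> Dyad p d Q S -> Dyad p d P S.
Proof.
move=> [r _ rP] [s _]; elim: s S => [|s IH] S /=; first by move=> ->; exists r.
case=> T /IH[k _ kT] TS; exists k.+1 => //; by exists T.
Qed.

Lemma D1_Dyad P Q : D1 p d P Q -> Dyad p d P Q.
Proof. by move=> PQ; exists 1%N => //; exists P. Qed.

Lemma Dext_countable : countable (\bigcup_m Dext p d m R0).
Proof.
have Dc r Q : countable (Dlev p d r Q).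
  elim: r => [|r IH] /=; first exact/finite_set_countable/finite_set1.
  apply: bigcup_countable => // P _.
  apply: finite_set_countable.
  apply: (sub_finite_set (B := (fun ji : {ffun 'I_n -> 'I_(2 ^ d)} *
      'I_(ntime p d (trunc P)) => child p P ji.1 ji.2) @` setT)).
    by move=> S [j [i ->]]; exists (j, i).
  exact/finite_image/finite_finset.
by apply: bigcup_countable => // m _; apply: bigcup_countable => // j _.
Qed.

Lemma cell_nested m r a b z w : (m <= r)%N ->
  rset p (cell m a z) `&` rset p (cell r b w) !=set0 ->
  Dlev p d (r - m) (cell m a z) (cell r b w).
Proof.
move=> mr meet; apply/Dlev_cell; exists b, w; rewrite subnKC//.
by move: meet; rewrite -{1}(subnKC mr) => /cell_meet_anc[? ?]; split.
Qed.

Lemma cside_leq m r : cside m <= cside r -> (r <= m)%N.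
Proof.
by case: (leqP r m) => // /cside_lt/lt_le_trans/[apply]; rewrite ltxx.
Qed.

Lemma le_cside m r : (r <= m)%N -> cside m <= cside r.
Proof. by rewrite leq_eqVlt => /predU1P[->//|/cside_lt/ltW]. Qed.

(** A free descendant of least level is maximal, so the family [Fmax] is nonempty. The chosen
    largest member then has level at most that of [S], and volume decreases with the level. *)
Lemma le_vol_Mset E m a z S : Dyad p d (cell m a z) S -> Efree p E S ->
  (vol (rset p S) <= vol (Mset p d E (cell m a z)))%E.
Proof.
set X := cell m a z => -[r _ SD] SE.
pose lev k := `[< exists Q, Dlev p d k X Q /\ Efree p E Q >].
have levP k Q : Dlev p d k X Q -> Efree p E Q -> lev k.
  by move=> QD QE; apply/asboolP; exists Q.
have exl : exists k, lev k by exists r; exact: levP SD SE.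
case: (ex_minnP exl) => k /asboolP[P [PD PE]] kmin.
have DE j Q : Dlev p d j X Q -> exists b w, Q = cell (m + j) b w.
  by move=> /Dlev_cell[b [w [-> _ _]]]; exists b, w.
have PF : Fmax p d E X P.
  split=> //; first by exists k.
  (* A free [Q] containing [P] has level at least that of [P] by minimality, so nestedness gives the
     reverse inclusion. *)
  move=> Q [j _ QD] QE PQ; apply/seteqP; split; last exact: PQ.
  have kj : (m + k <= m + j)%N.
    by rewrite leq_add2l; exact: kmin (levP _ _ QD QE).
  have [b [w eP]] := DE _ _ PD; have [b' [w' eQ]] := DE _ _ QD.
  move: PQ; rewrite eP eQ => PQ; apply: Dlev_sub (cell_nested kj _).
  by have [u uP] := rset_cell0 (m + k) b w; exists u; split=> //; exact: PQ.
have Fside Q : Fmax p d E X Q -> side Q <= side P.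
  move=> [[j _ QD] QE _].
  have [b [w ->]] := DE _ _ PD; have [b' [w' ->]] := DE _ _ QD.
  by apply: le_cside; rewrite leq_add2l; exact: kmin (levP _ _ QD QE).
rewrite /Mset; set F := (X in xget _ X).
have : exists A, F A by exists (rset p P), P.
move=> /(xgetPex set0)[Q [QF Qmax ->]].
have [[j _ QD] _ _] := QF.
have := Qmax _ PF.
have [b [w ->]] := DE _ _ PD; have [b' [w' ->]] := DE _ _ QD.
have [b2 [w2 ->]] := DE _ _ SD => /cside_leq jk.
rewrite !vol_cell lee_fin; apply: csize_homo; apply: leq_trans jk _.
by rewrite leq_add2l; exact: kmin (levP _ _ SD SE).
Qed.

(** [Dlev] adds generations at the bottom; here one is split off at the top. *)
Lemma Dlev_S r P Q : Dlev p d r.+1 P Q ->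
  exists2 T, D1 p d P T & Dlev p d r T Q.
Proof.
elim: r Q => [|r IH] Q /=; first by case=> _ -> PQ; exists Q.
by case=> S /IH[T PT TS] SQ; exists T => //; exists S.
Qed.

(** An offset of at most [th + C] moves the parent's index by at most [C]. Adding the shift [th] of
    the forward parent gives [th + C] again, so the bound survives any number of steps. *)
Lemma divz_drift (x D C th k : int) : 0 < k -> 0 <= D <= th + C ->
  th + C <= C * k -> 0 <= ((x + D) %/ k)%Z - (x %/ k)%Z <= C.
Proof.
move=> k0 /andP[D0 DC] CK.
have h1 := lez_floor x (lt0r_neq0 k0); have h2 := ltz_ceil x k0.
apply/andP; split; first by rewrite subr_ge0 lez_divRL//; lia.
by rewrite lerBlDr -ltzD1 ltz_divLR//; lia.
Qed.

(** * Volume of a family of children with one missing *)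

Local Notation pre A := (@vol_point R n @^-1` A).

Lemma measurable_cell m a z :
  measurable (pre (rset p (cell m a z))).
Proof.
rewrite rset_cell; apply: measurable_box => i; rewrite !mxE lerD2l.
by rewrite ler_wpM2r ?ler_nat// ltW// cside_gt0.
Qed.

Lemma vol_children_missing (A : set (prect R n)) m a z T :
  D1 p d (cell m a z) T -> ~ A T ->
  let U := \bigcup_(Q in A `&` D1 p d (cell m a z)) rset p Q in
  measurable (pre U) -> (vol U <= (csize m - csize m.+1)%:E)%E.
Proof.
move=> DT nT U; have [b [w [eT _ _]]] := (D1_cell _ _ _ _).1 DT.
have D1sub Q : D1 p d (cell m a z) Q -> rset p Q `<=` rset p (cell m a z).
  by move=> QD; apply: (Dlev_sub (r := 1)); exists (cell m a z).
have [mu muE] := vol_measure R n.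
have mT : measurable (pre (rset p T)).
  by rewrite eT; exact: measurable_cell.
have mC := measurable_cell m a z.
rewrite muE => mU.
have -> : (csize m - csize m.+1)%:E =
    mu (pre (rset p (cell m a z)) `\` pre (rset p T)).
  have muC := vol_cell m a z; have muT := vol_cell m.+1 b w.
  rewrite -eT muE in muT; rewrite muE in muC.
  have fin : (mu (pre (rset p (cell m a z))) < +oo)%E.
    by rewrite muC ltry.
  apply: etrans (esym (measureD mC mT fin)).
  rewrite setIidr; last by apply: preimage_subset; exact: D1sub.
  by rewrite EFinB -muC -muT.
apply: le_measure; rewrite ?inE//; first exact: measurableD.
move=> u [Q [AQ QD] uQ]; split; first exact: D1sub uQ.
move=> uT; apply: nT; suff <- : Q = T by [].
move: uQ uT; rewrite eT.
have [b' [w' [-> _ _]]] := (D1_cell _ _ _ _).1 QD => uQ uT.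
by have [|-> ->] := @cell_meet m.+1 b' b w' w; first by exists (vol_point u).
Qed.

(** The subtracted term is the inverse of the largest possible number of children of a cell, so one
    omitted child always occupies at least that fraction. *)
Definition shrink : R := 1 - ((2 ^ d) ^ n * `|Num.ceil (pow2dp p d)|%N)%:R^-1.

Lemma shrink_itv : 0 < shrink < 1.
Proof.
have N9 : 9 <= ((2 ^ d) ^ n * `|Num.ceil (pow2dp p d)|%N)%:R :> R.
  by rewrite ler_nat (leq_trans ceil_ge9)// leq_pmull// !expn_gt0.
rewrite /shrink subr_gt0 ltrBlDr ltrDl invr_gt0 invf_lt1; lra.
Qed.

Lemma csize_shrink m : csize m - csize m.+1 <= shrink * csize m.
Proof.
rewrite /shrink mulrBl mul1r lerB// (csizeS m) mulrA.
rewrite ler_piMl// ?(ltW (csize_gt0 _))//.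
have /andP[_ kc] := ntime_bounds (ctrunc m); rewrite -/(csteps m) in kc.
have k0 := csteps_gt0 m.
have c0 : (0 < `|Num.ceil (pow2dp p d)|)%N by have := ceil_ge9; lia.
rewrite mulrC ler_pdivrMr ?mul1r ?ltr0n ?muln_gt0 ?expn_gt0 ?c0//.
by rewrite ler_nat leq_pmul2l ?expn_gt0//; lia.
Qed.

(** * The stopping families *)

Section Stopping.
Variables (theta0 phi Phi : int) (E : set ('rV[R]_n * R)) (delta : R).
Hypothesis adm : admissible p d theta0 phi Phi.

Let Lambda := (delta%:E * vol (Mset p d E (shift p R0 Phi%:~R)))%E.
Let G := Gdelta p d E delta Phi%:~R R0.
Let F := Fdelta p d E delta Phi%:~R R0.
Let calS := Sk p d theta0 phi Phi E R0 Lambda G.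
Let fpar := fparents p d theta0 R0.
Let tau := tau_is p d theta0 phi Phi E R0 Lambda.

(** * Overshoot along a chain of forward parents *)

Let drift : int := Num.ceil (2 * theta0%:~R / (pow2dp p d - 1)).

(** The factor 2 in [drift] pays for rounding: only [csteps m >= 2^dp - 1] is known, and
    [2^dp >= 9]. This is the hypothesis of [divz_drift]. *)
Lemma drift_le m : theta0 + drift <= drift * csteps m.
Proof.
case: adm => -[t2 _ _] _ _ _ _.
have h9 := pow2dp_ge9; have := ceil_ge (2 * theta0%:~R / (pow2dp p d - 1)).
rewrite -/drift ler_pdivrMr; last lra.
move=> h1; have k9 := csteps_ge9 m.
have c0 : 0 <= drift.
  rewrite ceil_ge0; apply: (@lt_le_trans _ _ 0); first lra.
  by rewrite divr_ge0 ?mulr_ge0 ?ler0z//; [lia|lra].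
have k1 : pow2dp p d - 1 <= (csteps m)%:R.
  have /andP[fk _] := ntime_bounds (ctrunc m).
  have := floorD1_gt (pow2dp p d); rewrite intrD.
  have : (Num.floor (pow2dp p d))%:~R <= (csteps m)%:Z%:~R :> R.
    by rewrite ler_int.
  by rewrite -[(csteps m)%:Z%:~R]/((csteps m)%:R); lra.
have c0R : 0 <= drift%:~R :> R by rewrite ler0z.
have : (theta0 + drift)%:~R <= (drift * csteps m)%:~R :> R.
  by rewrite intrD intrM -[(csteps m)%:Z%:~R]/((csteps m)%:R); nra.
by rewrite ler_int.
Qed.

(** This comes from the bound on [phi] by the floor of [2^dp], with [phi >= 2]. An overshoot is thus
    shorter than one parent cell. *)
Lemma drift_lt m : theta0 + drift < csteps m.
Proof.
case: adm => -[_ p2 _] _ _ _ [h _].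
have /andP[fk _] := ntime_bounds (ctrunc m).
by move: h; rewrite -/drift -/(csteps m) in fk *; lia.
Qed.

Lemma theta0_ge2 : 2 <= theta0. Proof. by case: adm => -[]. Qed.

(** Smallness of M is used at two shifts only: 0, the rectangle itself, and -1, the preceding
    translate. The lower end is at most -1 by the last admissibility condition, the upper end is
    nonnegative since [theta0 <= Phi]. *)
Lemma theta_window (th : int) : -1 <= th <= 0 ->
  (phi - theta0)%:~R <= (th%:~R : R) <= (Phi - theta0)%:~R.
Proof.
case: adm => -[t2 _ _] _ /andP[pt tP] _ [_ h].
have c1 : 1 <= Num.ceil (4 * theta0%:~R / (pow2dp p d - 1)).
  rewrite -gtz0_ge1 ceil_gt0 divr_gt0 ?mulr_gt0 ?ltr0z//; first lia.
  by have := pow2dp_ge9; lra.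
by move=> ?; rewrite !ler_int; lia.
Qed.

Lemma fparent_cell m a z : (forall i, (a i %/ (2 ^ d) ^ m.+1)%N = 0%N) ->
  fparent p d theta0 R0 (cell m.+1 a z) =
  cell m (fun i => a i %/ 2 ^ d)%N ((z %/ csteps m)%Z + theta0).
Proof. by move=> a0; rewrite /fparent parent_cell// shift_cell. Qed.

(** [D] is the overshoot past the ordinary ancestor of the same level; its bound does not depend on
    [i]. *)
Lemma fparents_cell i m a z : (forall x, (a x %/ (2 ^ d) ^ (m + i))%N = 0%N) ->
  exists2 D : int, 0 <= D <= theta0 + drift &
  fpar i (cell (m + i) a z) =
  cell m (fun x => a x %/ (2 ^ d) ^ i)%N ((z %/ nsteps m i)%Z + D).
Proof.
have t2 := theta0_ge2.
elim: i m => [|i IH] m.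
  rewrite addn0 nsteps0 divz1 => _; exists 0.
    by have := drift_le 0; have := drift_lt 0; have := csteps_ge9 0; nia.
  rewrite addr0 /fpar /fparents /=; congr cell.
  by apply: funext => x; rewrite divn1.
rewrite -addSnnS => a0; have [D D0 e] := IH _ a0.
have k0 : 0 < (csteps m)%:Z by exact: csteps_gt0.
have := divz_drift (z %/ nsteps m.+1 i)%Z k0 D0 (drift_le m).
set x := (z %/ _)%Z => h.
exists (((x + D) %/ csteps m)%Z - (x %/ csteps m)%Z + theta0).
  by move: h => /andP[? ?]; lia.
rewrite /fpar /fparents iterS -/(fparents p d theta0 R0 i _) -/fpar e.
rewrite fparent_cell; last by move=> y; rewrite -divnMA -expnD addnC.
rewrite nstepsS mulnC divzMA_nat -/x; congr cell; last by lia.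
by apply: funext => y; rewrite -divnMA -expnSr.
Qed.

(** Some [S] in [F] meets the parent of [P], while no member of [F] meets [P]. Hence [S] is strictly
    smaller than the parent and lies in one of its children [T]. *)
Lemma Gdelta_witness P : G P -> exists m a z T S,
  [/\ P = cell m.+1 a z, D1 p d (parent p d R0 P) T, Dyad p d T S & F S].
Proof.
case=> -[m PD] PF [u [uP [S SF uS]]].
have [[r _ SD] _ _] := SF.1.
have R0D k Q : Dlev p d k R0 Q -> Dlev p d k (cell 0 (fun=> 0%N) 0) Q.
  by rewrite -R0_cell.
have /Dlev_cell[a [z [eP a0 _]]] := R0D _ _ PD.
have /Dlev_cell[b [w [eS _ _]]] := R0D _ _ SD.
rewrite !add0n in eP eS; subst P S; move: uP; rewrite parent_cell// => uP.
have [rm|mr] := leqP r m.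
  (* If [S] were at least as large as the parent, it would contain the parent and therefore [P]. *)
  exfalso; have [v vP] := rset_cell0 m.+1 a z.
  have : set0 v; last by [].
  rewrite -PF; split=> //; exists (cell r b w) => //.
  apply: (Dlev_sub (cell_nested rm _)).
    by exists u; split; [exact: uS|exact: uP].
  apply: (Dlev_sub (r := 1)) vP; eexists; first exact: erefl.
  by apply/D1_cell; exists a, z.
have meet : rset p (cell m (fun i => a i %/ 2 ^ d)%N (z %/ csteps m)%Z) `&`
  rset p (cell r b w) !=set0 by exists u.
have := cell_nested (ltnW mr) meet.
rewrite -(prednK (_ : 0 < r - m)%N) ?subn_gt0// => /Dlev_S[T PT TS].
exists m, a, z, T, (cell r b w); split=> //.
by exists (r - m).-1.
Qed.

(** A stopping time never exceeds the level of [P], so [i < N] steps end at level at least 1, where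
    a parent still exists. *)
Lemma tau_cell P N i : tau P N -> (i < N)%N -> exists m a z,
  P = cell (m.+1 + i) a z /\ forall x, (a x %/ (2 ^ d) ^ (m.+1 + i))%N = 0%N.
Proof.
case=> M [/Dext_cell[a [z [-> a0]]] /andP[_ NM] _ _] iN.
have e : M = ((M - i.+1).+1 + i)%N by lia.
by exists (M - i.+1)%N, a, z; rewrite -e.
Qed.

(** Members of [F] have volume at least [Lambda], whereas before the stopping time every M in the
    window is smaller; by [le_vol_Mset] no such member fits inside. *)
Lemma maxM_small P N i m a z (th : int) S : tau P N -> (1 <= i < N)%N ->
  fpar i P = cell m a z -> -1 <= th <= 0 ->
  Dyad p d (cell m a (z + th)) S -> F S -> False.
Proof.
case=> M [_ _ _ small] iN e th1 SD [[_ SE _] SL]; apply: (small i iN).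
apply: le_trans SL (le_trans (le_vol_Mset SD SE) _).
apply: ereal_sup_ubound; exists th%:~R.
  by rewrite /= in_itv /= theta_window.
by rewrite -/(fpar i P) e shift_cell.
Qed.

(** Moving back by the overshoot [D] gives the ordinary [i]-th ancestor of [P]. As [i >= 1], it
    contains the parent of [P], and with it the witness [S]. *)
Lemma Sk_anc P N i : G P -> tau P N -> (1 <= i < N)%N ->
  exists m a z D S, [/\ fpar i P = cell m.+1 a z, 0 <= D <= theta0 + drift,
    F S & Dyad p d (cell m.+1 a (z - D)) S].
Proof.
move=> GP tP /andP[i1 iN].
have [m [a [z [eP a0]]]] := tau_cell tP iN.
have [m' [a' [z' [T [S [_ PT TS SF]]]]]] := Gdelta_witness GP.
have [D D0 eD] := fparents_cell z a0.
exists m, (fun x => a x %/ (2 ^ d) ^ i)%N, ((z %/ nsteps m.+1 i)%Z + D), D, S.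
split=> //; first by rewrite eP.
rewrite addrK; apply: Dyad_trans (Dyad_trans (D1_Dyad PT) TS).
move: i1 a0 eP {iN eD}; case: i => // i _ a0 eP.
rewrite eP addnS parent_cell; last by rewrite -addnS.
exists i => //; apply/Dlev_cell; do 2 eexists; split=> // [x|].
  by rewrite -divnMA -expnS.
by rewrite nstepsSr -divzMA_nat.
Qed.

Lemma Sk_Dext k Q : calS k Q -> exists m a z,
  Q = cell m.+1 a z /\ forall x, (a x %/ (2 ^ d) ^ m.+1)%N = 0%N.
Proof.
case=> P [N [i [_ _ _ _ tQ]]].
have k0 : (0 < k)%N by case: tQ => m [_ /andP[]].
by have [m [a [z]]] := tau_cell tQ k0; rewrite addn0; exists m, a, z.
Qed.

(** For [i = 0], [Q] is in [G] and misses all of [F]; for [i >= 1], [maxM_small] applies at shift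
    0. *)
Lemma Sk_disjoint k Q S : calS k Q -> F S -> Dyad p d Q S -> False.
Proof.
case=> P [N [[|i] [GP tP iN eQ tQ]]] SF QS.
  have [m [a [z [T [S' [eP _ _ _]]]]]] := Gdelta_witness GP.
  case: GP => _ P0 _; move: QS; rewrite eQ /fparents /= eP => -[r _ rS].
  have /Dlev_cell[b [w [eS _ _]]] := rS.
  have [u uS] := rset_cell0 (m.+1 + r) b w; rewrite -eS in uS.
  have : set0 u; last by [].
  by rewrite -P0; split; [rewrite eP; exact: (Dlev_sub rS)|exists S].
have [m [a [z [D [S' [e _ _ _]]]]]] := Sk_anc (i := i.+1) GP tP iN.
apply: (maxM_small (th := 0) (S := S) tP _ e) => //.
by rewrite addr0 -e -[fpar _ _]eQ.
Qed.

(** Were all children in [calS k], the witness [S] attached to the temporally last one would lie in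
    some child, contradicting [Sk_disjoint]. *)
Lemma Sk_child_missing k m b z :
  exists2 T, D1 p d (cell m b z) T & ~ calS k T.
Proof.
apply: contrapT => no.
have h T : D1 p d (cell m b z) T -> calS k T.
  by move=> DT; apply: contrapT => nT; apply: no; exists T.
have k0 := csteps_gt0 m.
pose a := fun x => (b x * 2 ^ d)%N.
(* The last temporal index among the children: going back fewer than [csteps m] cells stays under
   the same parent. The spatial index [a] is an arbitrary choice. *)
pose w : int := z * csteps m + (csteps m)%:Z - 1.
have ab x : (a x %/ 2 ^ d)%N = b x by rewrite mulnK// expn_gt0.
have wD (D : int) : 0 <= D < csteps m -> ((w - D) %/ csteps m)%Z = z.
  move=> D0; rewrite /w -!addrA divzMDl ?gt_eqF// divz_small ?addr0//=.
  by lia.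
suff [T [S [DT SF TS]]] : exists T S,
    [/\ D1 p d (cell m b z) T, F S & Dyad p d T S].
  exact: (Sk_disjoint (h _ DT) SF TS).
have /h QS : D1 p d (cell m b z) (cell m.+1 a w).
  apply/D1_cell; exists a, w; split=> //.
  by rewrite -[w]subr0 wD//; lia.
have [m' [a' [z' [e a0]]]] := Sk_Dext QS.
case: QS => P [N [[|i] [GP tP iN eQ tQ]]].
  (* Here the last child is itself in [G], and the child [T] of the same parent contains [S]. *)
  have [_ [_ [_ [T [S [_ PT TS SF]]]]]] := Gdelta_witness GP.
  exists T, S; split=> //; move: PT.
  rewrite -[P]/(fparents p d theta0 R0 0 P) -eQ parent_cell; last first.
    by move: e => /cell_inj[[->] -> _].
  rewrite -[w]subr0 wD; last by lia.
  by congr (D1 _ _ (cell _ _ _) _); apply: funext.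
have [r [c [y [D [S [eD D0 SF SD]]]]]] := Sk_anc (i := i.+1) GP tP iN.
move: eQ; rewrite -/fpar eD => /cell_inj[[?] ? ?]; subst r c y.
(* Here [S] lies [D] cells before the last child, and [D < csteps m]. *)
exists (cell m.+1 a (w - D)), S; split=> //.
apply/D1_cell; exists a, (w - D); split=> //; apply: wD.
by have := drift_lt m; lia.
Qed.

(** One step along the chain lowers the stopping time by one. The second conclusion keeps the
    forward parent strictly before the stopping time of [P], where M is still small. *)
Lemma fparent_Sk k Q : (1 <= k)%N -> calS k.+1 Q ->
  calS k (fparent p d theta0 R0 Q) /\ exists P N i,
  [/\ G P, tau P N, (1 <= i < N)%N & fparent p d theta0 R0 Q = fpar i P].
Proof.
move=> k1 [P [N [i [GP tP iN eQ tQ]]]].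
have eF : fparent p d theta0 R0 Q = fpar i.+1 P by rewrite eQ.
have [m [a [z [eP a0]]]] := tau_cell tP iN.
have maxE j : maxM p d theta0 phi Phi E R0 j (fparent p d theta0 R0 Q) =
    maxM p d theta0 phi Phi E R0 j.+1 Q.
  by rewrite /maxM /fparents -iterSr.
have tF : tau (fparent p d theta0 R0 Q) k.
  case: tQ => M [/Dext_cell[b [w [eM b0]]] kM LM small].
  case: M kM => [|M] kM in eM b0; first by lia.
  exists M; split; [| lia | by rewrite maxE |].
    rewrite eM fparent_cell//; apply/Dext_cell.
    by do 2 eexists; split=> // x; rewrite -divnMA -expnS.
  by move=> j jk; rewrite maxE; apply: small; lia.
have iN1 : (i.+1 < N)%N.
  (* If [i + 1 = N], the chain of [P] stops exactly at the forward parent of [Q], so the stopping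
     time of [Q] would be 1 rather than [k + 1]. *)
  rewrite ltn_neqAle iN andbT; apply/eqP => iE.
  case: tQ => M [_ _ _ small]; apply: (small 1%N); first by rewrite ltnS.
  case: tP => M' [_ _ + _]; rewrite -iE.
  by rewrite -maxE /maxM eF /fpar /fparents.
split; last by exists P, N, i.+1.
by exists P, N, i.+1.
Qed.

(** Meeting rectangles of equal level coincide, and [nest] rules out different levels. *)
Lemma trivIset_fparent k : (1 <= k)%N ->
  trivIset [set fparent p d theta0 R0 P | P in calS k.+1] (rset p).
Proof.
move=> k1.
have nest P N i P' N' i' m r a b z w :
    G P -> tau P N -> (1 <= i < N)%N -> fpar i P = cell m a z ->
    G P' -> tau P' N' -> (1 <= i' < N')%N -> fpar i' P' = cell r b w ->
    (m < r)%N -> rset p (cell m a z) `&` rset p (cell r b w) !=set0 -> False.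
  move=> GP tP iN eX GP' tP' iN' eY mr meet.
  have [s [b' [w' [D [S [eD D0 SF SD]]]]]] := Sk_anc GP' tP' iN'.
  move: eD; rewrite eY => /cell_inj[? ? ?]; subst r b' w'.
  have [q qE] : exists q, s.+1 = (m + q.+1)%N by exists (s - m)%N; lia.
  rewrite qE in meet SD; have [ab zw] := cell_meet_anc meet.
  have n0 : 0 < (nsteps m q.+1)%:Z.
    by rewrite ltz_nat prodn_gt0// => j; exact: csteps_gt0.
  have Dn : D < nsteps m q.+1.
    apply: (@lt_le_trans _ _ (csteps m)%:Z); first by have := drift_lt m; lia.
    rewrite nstepsS lez_nat leq_pmulr// prodn_gt0// => j; exact: csteps_gt0.
  (* Moving the smaller cell back by [D], less than the length of one cell of level [m], leads into
     the larger cell or its immediate predecessor. *)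
  have th : -1 <= ((w - D) %/ nsteps m q.+1)%Z - z <= 0.
    have h1 := lez_floor w (lt0r_neq0 n0); have h2 := ltz_ceil w n0.
    rewrite zw in h1 h2; rewrite lerBrDr lerBlDr.
    apply/andP; split; first by rewrite lez_divRL//; lia.
    by rewrite -ltzD1 ltz_divLR//; lia.
  apply: (maxM_small (S := S) tP iN eX th) => //.
  apply: Dyad_trans SD; apply/Dyad_cell; exists q.+1, b, (w - D).
  by split=> //; lia.
move=> X Y [Q /(fparent_Sk k1)[SX [P [N [i [GP tP iN ->]]]]] <-].
move=> [Q' /(fparent_Sk k1)[SY [P' [N' [i' [GP' tP' iN' ->]]]]] <-].
have [m [a [z [_ [_ [eX _ _ _]]]]]] := Sk_anc GP tP iN.
have [r [b [w [_ [_ [eY _ _ _]]]]]] := Sk_anc GP' tP' iN'.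
rewrite eX eY => meet; have [mr|rm|mr] := ltngtP m r.
- by case: (nest _ _ _ _ _ _ _ _ _ _ _ _ GP tP iN eX GP' tP' iN' eY _ meet).
- rewrite setIC in meet.
  by case: (nest _ _ _ _ _ _ _ _ _ _ _ _ GP' tP' iN' eY GP tP iN eX _ meet).
- by move: meet; rewrite mr => /cell_meet[-> ->].
Qed.

(** * Geometric decay of the volumes *)

Lemma Sk_countable k : countable (calS k).
Proof.
apply: sub_countable Dext_countable; apply: subset_card_le => Q.
move=> /Sk_Dext[m [a [z [-> a0]]]]; exists m.+1 => //.
by apply/Dext_cell; exists a, z.
Qed.

Lemma measurable_Sk k Q : calS k Q -> measurable (pre (rset p Q)).
Proof. by move=> /Sk_Dext[m [a [z [-> _]]]]; exact: measurable_cell. Qed.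

Lemma vol_Sk_step k : (1 <= k)%N ->
  (vol (\bigcup_(Q in calS k.+1) rset p Q) <=
   shrink%:E * vol (\bigcup_(Q in calS k) rset p Q))%E.
Proof.
move=> k1; have [mu muE] := vol_measure R n; rewrite !muE.
(* Group [calS k.+1] by forward parent. The union of a group need not lie in [X], so it is compared
   with [X] by volume only. *)
pose fib X := [set Q | calS k.+1 Q /\ fparent p d theta0 R0 Q = X].
pose D := [set fparent p d theta0 R0 P | P in calS k.+1].
have DS : D `<=` calS k by move=> X [Q QS <-]; have [] := fparent_Sk k1 QS.
have Dc : countable D.
  exact: sub_countable (subset_card_le DS) (Sk_countable k).
have mfib X : measurable (pre (\bigcup_(Q in fib X) rset p Q)).
  rewrite preimage_bigcup; apply: countable_bigcup_measurable.
    by apply: sub_countable (Sk_countable k.+1); apply: subset_card_le => Q [].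
  by move=> Q [QS _]; exact: measurable_Sk QS.
have -> : pre (\bigcup_(Q in calS k.+1) rset p Q) =
    \bigcup_(X in D) pre (\bigcup_(Q in fib X) rset p Q).
  apply/seteqP; split=> u [Q].
    by move=> QS uQ; exists (fparent p d theta0 R0 Q); [exists Q|exists Q].
  by move=> _ [Q' [QS _] uQ]; exists Q'.
have s0 : 0 <= shrink by have /andP[/ltW] := shrink_itv.
apply: (@le_trans _ _
  (shrink%:E * mu (\bigcup_(X in D) pre (rset p X)))%E).
  apply: le_measure_bigcup => //.
  - move=> X Y DX DY [u uXY]; apply: (trivIset_fparent k1 DX DY).
    by exists (vol_point u).
  - by move=> X /DS/measurable_Sk.
  move=> X [Q0 Q0S eX]; rewrite -!muE.
  have [m [a [z [eQ0 a0]]]] := Sk_Dext Q0S.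
  pose a' := fun x => (a x %/ 2 ^ d)%N; pose z' := (z %/ csteps m)%Z.
  have eX' : X = cell m a' (z' + theta0) by rewrite -eX eQ0 fparent_cell.
  have [T DT nT] := Sk_child_missing k.+1 m a' z'.
  (* Undoing the shift by [theta0], the group consists of the members of [calS k.+1] under one
     ordinary parent, a translate of [X] with the same volume. *)
  have fibE : fib X = calS k.+1 `&` D1 p d (cell m a' z').
    apply/seteqP; split=> Q [QS].
      have [r [b [w [eQ b0]]]] := Sk_Dext QS.
      rewrite eX' eQ (fparent_cell _ b0) => /cell_inj[rm ba wz].
      subst r; split; first by rewrite -eQ.
      apply/D1_cell; exists b, w; split; first exact: erefl.
        by move=> x; rewrite -ba.
      exact: addIr wz.
    move=> /D1_cell[b [w [eQ ba wz]]]; split; first exact: QS.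
    have [r [b' [w' [+ b0]]]] := Sk_Dext QS.
    rewrite eQ => /cell_inj[[rm] bb' ww']; rewrite eX' fparent_cell; last first.
      by rewrite bb' rm.
    by rewrite wz; congr cell; apply: funext.
  have mfX := mfib X; rewrite fibE in mfX *.
  apply: le_trans (vol_children_missing DT nT mfX) _.
  by rewrite eX' vol_cell -EFinM lee_fin csize_shrink.
(* The forward parents belong to [calS k], so their union is contained in that of [calS k]. *)
apply: lee_wpmul2l; first by rewrite lee_fin.
have mS : measurable (pre (\bigcup_(Q in calS k) rset p Q)).
  rewrite preimage_bigcup; apply: countable_bigcup_measurable (Sk_countable k) _.
  by move=> Q; exact: measurable_Sk.
apply: le_measure; rewrite ?inE//.
  by apply: countable_bigcup_measurable => // X /DS/measurable_Sk.
by move=> u [X /DS XS uX]; exists X.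
Qed.

Lemma vol_Sk_decay k :
  (vol (\bigcup_(Q in calS k.+1) rset p Q) <=
   (shrink ^+ k)%:E * vol (\bigcup_(Q in calS 1%N) rset p Q))%E.
Proof.
elim: k => [|k IH]; first by rewrite expr0 mul1e.
apply: le_trans (vol_Sk_step _) _ => //; rewrite exprS EFinM -muleA.
by apply: lee_wpmul2l => //; rewrite lee_fin; have /andP[/ltW] := shrink_itv.
Qed.

Lemma Sk_proper k (C : set (prect R n)) : C `<=` calS k ->
  (forall P, C P -> C `<=` D1 p d (parent p d R0 P)) ->
  forall P, C P -> C `<` D1 p d (parent p d R0 P).
Proof.
move=> CS CD P CP; split; first exact: CD.
have [m [a [z [-> a0]]]] := Sk_Dext (CS _ CP).
rewrite parent_cell// => DC.
have [T DT nT] := Sk_child_missing k m (fun i => a i %/ 2 ^ d)%N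
  (z %/ csteps m)%Z.
by apply: nT; apply: CS; exact: DC.
Qed.

End Stopping.
End Cells.

Theorem lemma6p6 (R : realType) (n : nat) (p : R) (d : nat)
    (hn : (1 <= n)%N) (hp : 1 < p) (hd : (1 <= d)%N)
    (hdp : ln 9 / ln 2 <= d%:R * p) :
  exists2 lambda : R, 0 < lambda < 1 &
  forall (theta0 phi Phi : int), admissible p d theta0 phi Phi ->
  forall (E : set ('rV[R]_n * R)) (c delta : R),
    0 < c < 1 -> 0 < delta < 1 -> weakly_porous p d c delta Phi%:~R E ->
  forall R0 : prect R n, valid_prect R0 ->
  let Lambda := (delta%:E * vol (Mset p d E (shift p R0 Phi%:~R)))%E in
  let calS := Sk p d theta0 phi Phi E R0 Lambda
             (Gdelta p d E delta Phi%:~R R0) in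
  forall k : nat, (1 <= k)%N ->
  [/\ forall C : set (prect R n), C `<=` calS k -> C !=set0 ->
        (forall P, C P -> C `<=` D1 p d (parent p d R0 P)) ->
        forall P, C P -> C `<` D1 p d (parent p d R0 P),
      trivIset [set fparent p d theta0 R0 P | P in calS k.+1] (rset p) &
      (vol (\bigcup_(Q in calS k.+1) rset p Q)
       <= (lambda ^+ k)%:E * vol (\bigcup_(P in calS 1%N) rset p P))%E].
Proof.
(* The ratio is fixed before the shifts, the set and the rectangle, and depends on [n], [p], [d]
   only. *)
exists (shrink n p d); first exact: shrink_itv hdp.
move=> theta0 phi Phi adm E c delta _ _ _ R0 R0V Lambda calS k k1; split.
- by move=> C CS _; exact: Sk_proper CS.
- exact: trivIset_fparent.
- exact: vol_Sk_decay.
Qed.
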